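(* Let $K$ be a subfield of $\mathbb{C}$. (1) If $A$ is a generic two-dimensional commutative algebra over $K$, with three distinct nonzero idempotents $c_1,c_2,c_3$ and Peirce spectra $\sigma(c_i)=\{1,\lambda_i\}$, $i=1,2,3$, then $$4\lambda_1\lambda_2\lambda_3-\lambda_1-\lambda_2-\lambda_3+1=0$$ and $$\sum_{i=1}^3\frac{c_i}{\chi_{c_i}(\frac12)}=0,\qquad\text{where } \chi_{c_i}(\tfrac12)=(\tfrac12-1)(\tfrac12-\lambda_i)=\tfrac14(2\lambda_i-1).$$ (2) In the converse direction, given three numbers $\lambda_1,\lambda_2,\lambda_3\in K$ satisfying $$4\lambda_1\lambda_2\lambda_3-\lambda_1-\lambda_2-\lambda_3+1=0,$$ there exists a generic two-dimensional commutative algebra over $K$ such that $\sigma(c_i)=\{1,\lambda_i\}$, $i=1,2,3$, where $c_1,c_2,c_3$ are three distinct nonzero idempotents.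
   Context: An algebra means a finite-dimensional commutative, not necessarily associative, algebra over $K$. An idempotent is an element $c$ with $c^2=c$. For an idempotent $c$, $L_c$ denotes the multiplication operator $L_cx=cx$, $\sigma(c)$ denotes the Peirce spectrum of $c$, i.e. the spectrum of $L_c$, and $\chi_c(t)$ denotes the characteristic polynomial of $L_c$. In dimension two, $\sigma(c_i)=\{1,\lambda_i\}$ means that the eigenvalues of $L_{c_i}$, counted with multiplicity, are $1$ and $\lambda_i$. An algebra $A$ over $K$ of dimension $n$ is called generic if its complexification $A_{\mathbb{C}}$ (obtained by extending the ground field to $\mathbb{C}$) contains exactly $2^n$ distinct idempotents, including $0$. In part (1), the three nonzero idempotents are those of $A_{\mathbb{C}}$ if they do not all lie in $A$.
   Formalization: In part (2) the numbers λ1, λ2, λ3 are assumed different from 1/2: the triple (1/2, 1/2, t) satisfies the relation for every t, but no generic two-dimensional algebra has an idempotent with λ = 1/2. *)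

(* Defs.v *)
From HB Require Import structures.
From mathcomp Require Import all_boot all_order all_algebra.
From mathcomp Require Import complex.
From mathcomp Require Import reals.

Set Implicit Arguments.
Unset Strict Implicit.
Unset Printing Implicit Defensive.

Import GRing.Theory.
Local Open Scope ring_scope.

(* Finite-dimensional commutative, not necessarily associative or unital,
   algebras.  Linearity on the left follows from [alg_mulC]. *)
Record comm_algebra (K : fieldType) := CommAlgebra {
  alg_sort :> vectType K;
  alg_mul : alg_sort -> alg_sort -> alg_sort;
  alg_mulC : commutative alg_mul;
  alg_mul_linear : forall x, linear (alg_mul x)
}.

HB.instance Definition _ (K : fieldType) (A : comm_algebra K) (x : A) :=
  GRing.isLinear.Build K A A *:%R (alg_mul x) (alg_mul_linear x).

Section Algebra.
Variables (K : fieldType) (A : comm_algebra K).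

Definition alg_idempotent (c : A) : bool := alg_mul c c == c.

Definition mul_op (c : A) : 'End(A) := linfun (alg_mul c).

Definition peirce_poly (c : A) : {poly K} :=
  char_poly (passmx.mxof (vbasis {:A}) (vbasis {:A}) (mul_op c)).

(* The sequence [s] lists the eigenvalues of the multiplication operator
   with their algebraic multiplicities. *)
Definition has_peirce_spectrum (c : A) (s : seq K) : Prop :=
  peirce_poly c = \prod_(a <- s) ('X - a%:P).

End Algebra.

Section BaseChange.
Variables (K L : fieldType) (iota : {rmorphism K -> L}) (A : comm_algebra K).

Local Notation n := (\dim {:A}).
Local Notation e := (vbasis {:A}).

(* The algebra A tensored with L: the basis (e_i) of A becomes the standard
   basis of L^n, and the structure constants of A are transported by iota. *)
Definition base_change_mul (x y : 'rV[L]_n) : 'rV[L]_n :=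
  \row_k \sum_(i < n) \sum_(j < n)
    x 0 i * y 0 j * iota (coord e k (alg_mul e`_i e`_j)).

Fact base_change_mulC : commutative base_change_mul.
Proof.
move=> x y; apply/rowP => k; rewrite !mxE exchange_big /=.
apply: eq_bigr => i _; apply: eq_bigr => j _.
by rewrite alg_mulC [x 0 _ * _]mulrC.
Qed.

Fact base_change_mul_linear x : linear (base_change_mul x).
Proof.
move=> a y z; apply/rowP => k; rewrite !mxE mulr_sumr -big_split /=.
apply: eq_bigr => i _; rewrite mulr_sumr -big_split /=.
apply: eq_bigr => j _; rewrite !mxE mulrDr mulrDl; congr (_ + _).
by rewrite !mulrA [a * _]mulrC.
Qed.

Definition base_change : comm_algebra L :=
  CommAlgebra base_change_mulC base_change_mul_linear.

Definition base_change_emb (x : A) : base_change := \row_k iota (coord e k x).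

Fact base_change_embM x y :
  base_change_emb (alg_mul x y)
  = alg_mul (base_change_emb x) (base_change_emb y).
Proof.
apply/rowP => k; rewrite !mxE.
rewrite {1}(coord_vbasis (memvf x)) {1}(coord_vbasis (memvf y)).
rewrite alg_mulC !linear_sum rmorph_sum /=.
apply: eq_bigr => i _; rewrite linearZ /= alg_mulC linear_sum.
rewrite linearZ linear_sum /=.
rewrite mulr_sumr rmorph_sum /=; apply: eq_bigr => j _.
by rewrite !linearZ !rmorphM /= !mxE mulrA.
Qed.

End BaseChange.

(* [iota] is the inclusion of the ground field in the complex numbers. *)
Definition generic (R : realType) (K : fieldType)
    (iota : {rmorphism K -> R[i]}) (A : comm_algebra K) : Prop :=
  exists s : seq (base_change iota A),
    [/\ uniq s, size s = (2 ^ \dim {:A})%N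
      & forall x, (x \in s) = alg_idempotent x].

Definition peirce_relation (F : fieldType) (lam : 'I_3 -> F) : Prop :=
  4 * (\prod_i lam i) - (\sum_i lam i) + 1 = 0.

(* The nonvanishing of the denominators is part of the assertion, because
   the inverse of 0 is 0 here. *)
Definition three_idempotent_identities (F : fieldType) (B : comm_algebra F) :=
  forall (c : 'I_3 -> B) (lam : 'I_3 -> F),
    injective c ->
    (forall i, c i != 0) ->
    (forall i, alg_idempotent (c i)) ->
    (forall i, has_peirce_spectrum (c i) [:: 1; lam i]) ->
    [/\ peirce_relation lam,
        forall i, [/\ (peirce_poly (c i)).[2^-1] = (2^-1 - 1) * (2^-1 - lam i),
                      (peirce_poly (c i)).[2^-1] = 4^-1 * (2 * lam i - 1)
                    & (peirce_poly (c i)).[2^-1] != 0]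
      & \sum_i ((peirce_poly (c i)).[2^-1])^-1 *: c i = 0].

(* Main.v *)
Require Import Defs.
From mathcomp Require Import all_boot all_order all_algebra.
From mathcomp Require Import complex.
From mathcomp Require Import reals.
From mathcomp Require Import ring.

Import GRing.Theory.
Local Open Scope ring_scope.

Set Implicit Arguments.
Unset Strict Implicit.

(** Two distinct nonzero idempotents [c], [d] of a two-dimensional algebra form
    a basis, so the algebra is determined by their product
    [c d = a c + b d].  The operators [L_c] and [L_d] are triangular in this
    basis, with spectra [{1, b}] and [{1, a}] ([idempotent_spectrum]).  A
    vector [x c + y d] is idempotent when [x (x + 2 a y - 1) = 0] and
    [y (y + 2 b x - 1) = 0] ([idempotent_combination]); hence a third nonzero
    idempotent is a solution of the linear system [x + 2 a y = 1],
    [y + 2 b x = 1], and its second eigenvalue is [x + a y - b x], that is,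
    [(x + y) / 2] ([spectrum_combination]).

    For the direct part, eliminating [x] and [y] gives the relation between the
    eigenvalues and the linear dependence between the idempotents.  The
    denominators are nonzero because otherwise [a = b = 1/2], and then every
    point of the line through [c] and [d] is idempotent ([five_idempotents]),
    against genericity.  The argument is carried out in an algebra with at most
    four idempotents ([three_idempotent_identities_of_bound]), which covers
    both the generic algebra and its complexification.

    For the converse, take the algebra with [a = lam_2] and [b = lam_1].  The
    relation and [lam_i <> 1/2] make the linear system nonsingular, with a
    solution whose coordinates are both nonzero; this solution is the third
    idempotent and has eigenvalue [lam_3].  The classification of idempotents
    ([idempotents_of_pair]), applied over the complex numbers, shows that the
    algebra is generic ([generic_of_pair]). *)


Lemma forall_ord3 (P : 'I_3 -> Prop) :
  P ord0 -> P (lift ord0 ord0) -> P (lift ord0 (lift ord0 ord0)) ->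
  forall i, P i.
Proof.
move=> P0 P1 P2 [[|[|[|//]]] lti].
- by rewrite (_ : Ordinal lti = ord0) //; apply: val_inj.
- by rewrite (_ : Ordinal lti = lift ord0 ord0) //; apply: val_inj.
- by rewrite (_ : Ordinal lti = lift ord0 (lift ord0 ord0)) //; apply: val_inj.
Qed.

(** * Characteristic polynomials of multiplication operators *)

Section Spectrum.
Variables (F : fieldType) (A : comm_algebra F).

Lemma alg_mulDr (x y z : A) : alg_mul x (y + z) = alg_mul x y + alg_mul x z.
Proof. exact: linearD. Qed.

Lemma alg_mulZr (a : F) (x y : A) : alg_mul x (a *: y) = a *: alg_mul x y.
Proof. exact: linearZ. Qed.

Lemma alg_mulDl (x y z : A) : alg_mul (y + z) x = alg_mul y x + alg_mul z x.
Proof. by rewrite alg_mulC alg_mulDr !(alg_mulC x). Qed.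

Lemma alg_mulZl (a : F) (x y : A) : alg_mul (a *: y) x = a *: alg_mul y x.
Proof. by rewrite alg_mulC alg_mulZr (alg_mulC x). Qed.

(** An idempotent [a c] on the line of an idempotent [c <> 0] has [a^2 = a]:
    hence distinct nonzero idempotents are linearly independent. *)
Lemma idempotentZ_eq (c : A) (a : F) :
  alg_idempotent c -> alg_idempotent (a *: c) -> a *: c = 0 \/ a *: c = c.
Proof.
rewrite /alg_idempotent alg_mulZl alg_mulZr => /eqP -> /eqP e.
have [->|c0] := eqVneq c 0; first by left; rewrite scaler0.
have : (a * a - a) *: c = 0 by rewrite scalerBl -scalerA e subrr.
move/eqP; rewrite scaler_eq0 (negPf c0) orbF.
rewrite (_ : a * a - a = a * (a - 1)); last by ring.
rewrite mulf_eq0 subr_eq0 => /orP[] /eqP ->; first by left; rewrite scale0r.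
by right; rewrite scale1r.
Qed.

(** The change of basis matrices [P] and [Q] are inverse to each other, and
    [P] stays invertible after embedding its entries in the polynomials.  This
    is what frees the Peirce polynomial from the arbitrary basis that defines
    it. *)
Lemma char_poly_mxof (e f : (\dim {:A}).-tuple A) (h : 'End(A)) :
  basis_of {:A} e -> basis_of {:A} f ->
  char_poly (passmx.mxof e e h) = char_poly (passmx.mxof f f h).
Proof.
move=> be bf.
set P := passmx.mxof e f \1%VF; set Q := passmx.mxof f e \1%VF.
have PQ : P *m Q = 1%:M.
  by rewrite -passmx.mxof_comp // comp_lfun1l passmx.mxof1 ?(basis_free be).
have /mulmx1C QP := PQ.
have -> : passmx.mxof e e h = P *m passmx.mxof f f h *m Q.
  by rewrite -!passmx.mxof_comp // comp_lfun1r comp_lfun1l.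
set M := passmx.mxof f f h.
have PQp : map_mx polyC P *m map_mx polyC Q = 1%:M :> 'M[{poly F}]__.
  by rewrite -map_mxM PQ map_mx1.
rewrite /char_poly /char_poly_mx.
have -> : 'X%:M - map_mx polyC (P *m M *m Q)
    = map_mx polyC P *m ('X%:M - map_mx polyC M) *m map_mx polyC Q.
  rewrite mulmxBr mulmxBl -!map_mxM; congr (_ - _).
  by rewrite mul_mx_scalar -scalemxAl PQp scalemx1.
by rewrite !det_mulmx mulrAC -det_mulmx PQp det1 mul1r.
Qed.

Hypothesis dimA : \dim {:A} = 2%N.

Lemma idempotent_pair_free (c d : A) :
  c != 0 -> d != 0 -> c != d -> alg_idempotent c -> alg_idempotent d ->
  free [:: c; d].
Proof.
move=> c0 d0 cd cc dd.
rewrite free_cons seq1_free d0 andbT span_seq1.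
apply/vlineP => -[a ca].
move: (cc) c0 cd; rewrite ca.
by move=> /(idempotentZ_eq dd) [] ->; rewrite eqxx.
Qed.

Lemma basis_pair (c d : A) : free [:: c; d] -> basis_of {:A} [:: c; d].
Proof. by move=> fr; rewrite basisEfree fr subvf /= dimA. Qed.

Lemma pair_coordinates (c d : A) : free [:: c; d] ->
  forall z, exists x y : F, z = x *: c + y *: d.
Proof.
move=> /basis_pair /span_basis sp z.
have : z \in {:A}%VS by exact: memvf.
rewrite -sp span_cons span_seq1 => /memv_addP[u /vlineP[x ->] [v]].
by move=> /vlineP[y ->] ->; exists x, y.
Qed.

Lemma pair_coordinates_inj (c d : A) (x y x' y' : F) : free [:: c; d] ->
  x *: c + y *: d = x' *: c + y' *: d -> x = x' /\ y = y'.
Proof.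
move=> fr e.
have {e} : (x - x') *: c + (y - y') *: d = 0.
  by rewrite !scalerBl addrACA e -opprD subrr.
move: fr; rewrite free_cons seq1_free span_seq1 => /andP[/vlineP cd d0].
have [/eqP|xx] := eqVneq (x - x') 0.
  rewrite subr_eq0 => /eqP ->; rewrite subrr scale0r add0r => /eqP.
  by rewrite scaler_eq0 (negPf d0) orbF subr_eq0 => /eqP.
move=> /eqP; rewrite addr_eq0 => /eqP e; case: cd.
exists (- ((x - x')^-1 * (y - y'))).
by rewrite scaleNr -scalerA -scalerN -e scalerA mulVf // scale1r.
Qed.

(** In the basis [c, d] the operator [L_c] is triangular with diagonal
    [1, b]. *)
Lemma idempotent_spectrum (c d : A) (a b : F) :
  free [:: c; d] -> alg_idempotent c -> alg_mul c d = a *: c + b *: d ->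
  has_peirce_spectrum c [:: 1; b].
Proof.
move=> fr /eqP cc cd.
(* The matrix has size [\dim A], which equals 2 but is not convertible to it,
   so the entries are indexed through the values of the ordinals. *)
have sz : size [:: c; d] == \dim {:A} by rewrite dimA.
pose e := Tuple sz.
have be : basis_of {:A} e by exact: basis_pair.
rewrite /has_peirce_spectrum /peirce_poly.
rewrite (char_poly_mxof _ (vbasisP _) be).
set M := passmx.mxof _ _ _.
have ME i j : M i j = coord e j (alg_mul c e`_i).
  by rewrite !mxE /= passmx.vecof_delta lfunE.
have lt1 : (1 < \dim {:A})%N by rewrite dimA.
have lt0 : (0 < \dim {:A})%N by rewrite dimA.
have M0 (i j : 'I_(\dim {:A})) : i = 0%N :> nat -> M i j = (i == j)%:R.
  move=> i0; rewrite ME i0 /= cc.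
  by rewrite (_ : c = e`_i) ?coord_free ?(basis_free be) // i0.
have M1 (i : 'I_(\dim {:A})) : i = 1%N :> nat -> M i i = b.
  move=> i1; rewrite (_ : i = Ordinal lt1); last exact: val_inj.
  rewrite ME /= cd linearP linearZ /=.
  have := coord_free (Ordinal lt0) (Ordinal lt1) (basis_free be).
  have := coord_free (Ordinal lt1) (Ordinal lt1) (basis_free be).
  by rewrite /= => -> ->; rewrite mulr0 mulr1 add0r.
rewrite char_poly_trig; last first.
  apply/is_trig_mxP => i j ij; rewrite M0 ?(gtn_eqF ij) //.
    by rewrite -val_eqE /= ltn_eqF.
  by case: i j ij => [[|i] lti] [j ltj] //= ij; move: ltj; rewrite dimA;
    case: j ij => [|[|]].
rewrite (eq_bigr (fun i : 'I_(\dim {:A}) => 'X - (nth 0 [:: 1; b] i)%:P)).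
  rewrite -(big_mkord xpredT (fun i => 'X - (nth 0 [:: 1; b] i)%:P)) dimA.
  by rewrite !big_nat_recl // big_nil !big_cons big_nil.
move=> i _; congr (_ - _%:P).
case: (i) (M0 i i) (M1 i) => [[|[|k]] ltk] /=.
- by move=> ->.
- by move=> _ ->.
- by exfalso; move: ltk; rewrite dimA.
Qed.

Lemma spectrum_inj (c : A) (a b : F) :
  has_peirce_spectrum c [:: 1; a] -> has_peirce_spectrum c [:: 1; b] -> a = b.
Proof.
rewrite /has_peirce_spectrum => ->; rewrite !big_cons !big_nil !mulr1.
move=> /(mulfI (negbT (polyXsubC_eq0 1))) e.
by apply/eqP; rewrite -subr_eq0 -hornerXsubC -e hornerXsubC subrr.
Qed.

End Spectrum.

(** * Algebras spanned by two idempotents *)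

Section Combination.
Variables (F : fieldType) (V : lmodType F) (u v : V).

Lemma combinationD (x y x' y' : F) :
  (x *: u + y *: v) + (x' *: u + y' *: v) = (x + x') *: u + (y + y') *: v.
Proof. by rewrite addrACA -!scalerDl. Qed.

Lemma combinationZ (t x y : F) :
  t *: (x *: u + y *: v) = (t * x) *: u + (t * y) *: v.
Proof. by rewrite scalerDr !scalerA. Qed.

Lemma combinationl (x : F) : x *: u = x *: u + 0 *: v.
Proof. by rewrite scale0r addr0. Qed.

Lemma combinationr (y : F) : y *: v = 0 *: u + y *: v.
Proof. by rewrite scale0r add0r. Qed.

End Combination.

Lemma idempotent0 (F : fieldType) (A : comm_algebra F) :
  alg_idempotent (0 : A).
Proof. exact/eqP/linear0. Qed.

Section Pair.
Variables (F : fieldType) (A : comm_algebra F).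
Hypothesis dimA : \dim {:A} = 2%N.
Variables (c d : A) (a b : F).
Hypotheses (c0 : c != 0) (d0 : d != 0) (cd : c != d).
Hypotheses (cc : alg_idempotent c) (dd : alg_idempotent d).
Hypothesis mulcd : alg_mul c d = a *: c + b *: d.

Let fr : free [:: c; d] := idempotent_pair_free c0 d0 cd cc dd.

Lemma combination_mul (x y x' y' : F) :
  alg_mul (x *: c + y *: d) (x' *: c + y' *: d)
  = (x * x' + a * (x * y' + y * x')) *: c
    + (y * y' + b * (x * y' + y * x')) *: d.
Proof.
rewrite alg_mulDl !alg_mulZl !alg_mulDr !alg_mulZr (alg_mulC d c) mulcd.
rewrite (eqP cc) (eqP dd) (combinationl c d x') (combinationr c d y').
rewrite !(combinationZ, combinationD).
by congr (_ *: _ + _ *: _); ring.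
Qed.

(** The quadratic system that governs all idempotents of the algebra: apart
    from [0], [c] and [d], its solutions have [x] and [y] both nonzero and
    satisfy the linear system [x + 2 a y = 1], [y + 2 b x = 1]. *)
Lemma idempotent_combination (x y : F) :
  alg_idempotent (x *: c + y *: d)
  = (x * (x + 2 * a * y - 1) == 0) && (y * (y + 2 * b * x - 1) == 0).
Proof.
rewrite /alg_idempotent combination_mul.
rewrite (_ : x * x + _ = x * (x + 2 * a * y)); last by ring.
rewrite (_ : y * y + _ = y * (y + 2 * b * x)); last by ring.
rewrite 2!mulrBr !mulr1 !subr_eq0; apply/eqP/andP=> [|[/eqP -> /eqP -> //]].
by move=> /(pair_coordinates_inj fr) [-> ->]; rewrite !eqxx.
Qed.

Lemma combination_eq (x y x' y' : F) :
  (x *: c + y *: d == x' *: c + y' *: d) = (x == x') && (y == y').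
Proof.
apply/eqP/andP => [/(pair_coordinates_inj fr) [-> ->]|[/eqP -> /eqP -> //]].
by rewrite !eqxx.
Qed.

Lemma combination_eq0 (x y : F) :
  (x *: c + y *: d == 0) = (x == 0) && (y == 0).
Proof. by rewrite -combination_eq !scale0r addr0. Qed.

Lemma combination_eqc (x y : F) :
  (x *: c + y *: d == c) = (x == 1) && (y == 0).
Proof. by rewrite -combination_eq scale1r scale0r addr0. Qed.

Lemma combination_eqd (x y : F) :
  (x *: c + y *: d == d) = (x == 0) && (y == 1).
Proof. by rewrite -combination_eq scale1r scale0r add0r. Qed.

Lemma spectrum_left : has_peirce_spectrum c [:: 1; b].
Proof. exact: (idempotent_spectrum dimA fr cc mulcd). Qed.

Lemma spectrum_right : has_peirce_spectrum d [:: 1; a].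
Proof.
apply: (@idempotent_spectrum _ _ dimA d c b a) => //.
  by apply: idempotent_pair_free => //; rewrite eq_sym.
by rewrite alg_mulC mulcd addrC.
Qed.

(** In the basis [z, c] with [z = x c + y d], the coefficient of [c] in [z c]
    gives the eigenvalue. *)
Lemma spectrum_combination (x y : F) : y != 0 ->
  alg_idempotent (x *: c + y *: d) ->
  has_peirce_spectrum (x *: c + y *: d) [:: 1; x + a * y - b * x].
Proof.
move=> y0 iz.
apply: (@idempotent_spectrum _ _ dimA _ c b) => //.
  by apply: idempotent_pair_free => //;
    rewrite ?combination_eq0 ?combination_eqc (negPf y0) andbF.
have := combination_mul x y 1 0; rewrite -combinationl scale1r => ->.
rewrite (combinationl c d (x + a * y - b * x)).
rewrite !(combinationZ, combinationD).
by congr (_ *: _ + _ *: _); ring.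
Qed.

(** Since [1 - 4 a b] is the determinant of the linear system satisfied by
    the coordinates of an idempotent off the lines of [c] and [d], there is at
    most one such idempotent. *)
Lemma idempotents_of_pair (x y : F) : 1 - 4 * a * b != 0 ->
    x != 0 -> y != 0 -> x + 2 * a * y = 1 -> y + 2 * b * x = 1 ->
  forall z, (z \in [:: 0; c; d; x *: c + y *: d]) = alg_idempotent z.
Proof.
move=> D0 x0 y0 ex ey z.
have [x' [y' ->]] := pair_coordinates dimA fr z.
rewrite !inE combination_eq0 combination_eqc combination_eqd combination_eq.
rewrite idempotent_combination !mulf_eq0 !subr_eq0.
have [->|x'0] /= := eqVneq x' 0.
  rewrite mulr0 addr0 [0 == 1]eq_sym oner_eq0 [0 == x]eq_sym.
  by rewrite (negPf x0) /= ?orbF.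
have [->|y'0] /= := eqVneq y' 0.
  by rewrite mulr0 addr0 [0 == y]eq_sym (negPf y0) !andbF /= andbT !orbF.
rewrite andbF /=; apply/andP/andP => [[/eqP -> /eqP ->]|[/eqP ex' /eqP ey']].
  by rewrite ex ey.
split; apply/eqP; apply: (mulfI D0).
  have -> : (1 - 4 * a * b) * x'
      = x' + 2 * a * y' - 2 * a * (y' + 2 * b * x') by ring.
  have -> : (1 - 4 * a * b) * x
      = x + 2 * a * y - 2 * a * (y + 2 * b * x) by ring.
  by rewrite ex ey ex' ey'.
have -> : (1 - 4 * a * b) * y'
    = y' + 2 * b * x' - 2 * b * (x' + 2 * a * y') by ring.
have -> : (1 - 4 * a * b) * y
    = y + 2 * b * x - 2 * b * (x + 2 * a * y) by ring.
by rewrite ex ey ex' ey'.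
Qed.

(** When [a = b = 1/2] the two linear equations coincide, and the whole line
    through [c] and [d] consists of idempotents. *)
Lemma five_idempotents : [pchar F] =i pred0 -> 2 * a = 1 -> 2 * b = 1 ->
  exists s : seq A, [/\ uniq s, all (@alg_idempotent _ A) s & size s = 5%N].
Proof.
move=> char0 ea eb.
pose p (t : F) := t *: c + (1 - t) *: d.
have ip t : alg_idempotent (p t).
  by rewrite idempotent_combination ea eb; apply/andP; split; apply/eqP; ring.
have p0 t : 0 != p t.
  rewrite eq_sym combination_eq0.
  by have [->|] := eqVneq t 0; rewrite //= subr0 oner_eq0.
have pI : injective p by move=> t u /(pair_coordinates_inj fr) [].
have natI : injective (fun n : nat => n%:R : F).
  suff le_natI (m n : nat) : (m <= n)%N -> m%:R = n%:R :> F -> m = n.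
    by move=> m n e; case: (leqP m n) => [|/ltnW] le; first exact: le_natI;
      apply/esym/le_natI.
  move=> le_mn /eqP; rewrite eq_sym -subr_eq0 -natrB // (pcharf0P F).1 //.
  by rewrite subn_eq0 => le_nm; apply/eqP; rewrite eqn_leq le_mn.
exists (0 :: [seq p n%:R | n <- iota 0 4]); split => //.
  rewrite /= -/(uniq (map _ _)).
  apply/andP; split; first by rewrite !inE !(negPf (p0 _)).
  exact: (map_inj_uniq (inj_comp pI natI) (iota 0 4)).
by rewrite /= !ip idempotent0.
Qed.

End Pair.

(** * Identities between three idempotents *)

(** Genericity enters only through the bound on the number of idempotents,
    a property shared by an algebra and its base change.  With the product
    [c1 c2 = a c1 + b c2] and [c3 = x c1 + y c2], the three eigenvalues are
    [b], [a] and [l3], where [2 l3 = x + y], so that both identities follow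
    from [x + 2 a y = 1] and [y + 2 b x = 1].  If one of the denominators
    vanished, these equations would make all of them vanish, in particular
    [a = b = 1/2], which gives too many idempotents. *)
Lemma three_idempotent_identities_of_bound (F : fieldType) (B : comm_algebra F) :
    [pchar F] =i pred0 -> \dim {:B} = 2%N ->
    (forall s : seq B,
       uniq s -> all (@alg_idempotent _ B) s -> (size s <= 4)%N) ->
  three_idempotent_identities B.
Proof.
move=> char0 dimB bound c lam injc nzc idc spc.
have two0 : 2 != 0 :> F by rewrite (pcharf0P F).1.
have four0 : 4 != 0 :> F by rewrite (pcharf0P F).1.
have chiE i : (peirce_poly (c i)).[2^-1] = 4^-1 * (2 * lam i - 1).
  rewrite spc !big_cons big_nil mulr1 hornerM !hornerXsubC.
  by field; rewrite two0 four0.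
set c1 := c ord0; set c2 := c (lift ord0 ord0).
set c3 := c (lift ord0 (lift ord0 ord0)).
have c12 : c1 != c2 by rewrite (inj_eq injc).
have c31 : c3 != c1 by rewrite (inj_eq injc).
have c32 : c3 != c2 by rewrite (inj_eq injc).
have c10 : c1 != 0 by exact: nzc.
have c20 : c2 != 0 by exact: nzc.
have i1 : alg_idempotent c1 by exact: idc.
have i2 : alg_idempotent c2 by exact: idc.
have fr := idempotent_pair_free c10 c20 c12 i1 i2.
have [a [b e12]] := pair_coordinates dimB fr (alg_mul c1 c2).
have [x [y e3]] := pair_coordinates dimB fr c3.
have lam1 : lam ord0 = b.
  exact: spectrum_inj (spc _) (spectrum_left dimB c10 c20 c12 i1 i2 e12).
have lam2 : lam (lift ord0 ord0) = a.
  exact: spectrum_inj (spc _) (spectrum_right dimB c10 c20 c12 i1 i2 e12).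
have := idc (lift ord0 (lift ord0 ord0)); rewrite -/c3 e3 => i3.
move: (i3); rewrite (idempotent_combination c10 c20 c12 i1 i2 e12).
rewrite !mulf_eq0 !subr_eq0.
have x0 : x != 0.
  apply/negP => /eqP x0; move: (i3) (c32) (nzc (lift ord0 (lift ord0 ord0))).
  rewrite -/c3 e3 x0 scale0r add0r => /(idempotentZ_eq i2) [] -> ;
    by rewrite eqxx.
have y0 : y != 0.
  apply/negP => /eqP y0; move: (i3) (c31) (nzc (lift ord0 (lift ord0 ord0))).
  rewrite -/c3 e3 y0 scale0r addr0 => /(idempotentZ_eq i1) [] -> ;
    by rewrite eqxx.
rewrite (negPf x0) (negPf y0) /= => /andP[/eqP ex /eqP ey].
have lam3 : lam (lift ord0 (lift ord0 ord0)) = x + a * y - b * x.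
  apply: spectrum_inj (spc _) _; rewrite -/c3 e3.
  exact: (spectrum_combination dimB c10 c20 c12 i1 i2 e12).
have half : ~ (2 * a = 1 /\ 2 * b = 1).
  move=> [ea eb].
  have [s [us als szs]] := five_idempotents c10 c20 c12 i1 i2 e12 char0 ea eb.
  by have := bound s us als; rewrite szs.
set l3 := x + a * y - b * x in lam3.
have l3E : 2 * l3 = x + y.
  have -> : 2 * l3 = 2 * x + (x + 2 * a * y - x) - (y + 2 * b * x - y).
    by rewrite /l3; ring.
  by rewrite ex ey; ring.
have a1 : x + y = 1 -> 2 * a = 1.
  move=> xy; apply: (mulIf y0); rewrite mul1r.
  by apply: (addrI x); rewrite ex xy.
have b1 : x + y = 1 -> 2 * b = 1.
  move=> xy; apply: (mulIf x0); rewrite mul1r.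
  by apply: (addrI y); rewrite ey addrC.
have lam1_neq : 2 * b - 1 != 0.
  rewrite subr_eq0; apply/negP => /eqP eb.
  have xy : x + y = 1 by rewrite -ey eb mul1r addrC.
  by apply: half; split; [exact: a1|].
have lam2_neq : 2 * a - 1 != 0.
  rewrite subr_eq0; apply/negP => /eqP ea.
  have xy : x + y = 1 by rewrite -ex ea mul1r.
  by apply: half; split; [|exact: b1].
have lam3_neq : 2 * l3 - 1 != 0.
  rewrite l3E subr_eq0; apply/negP => /eqP xy.
  by apply: half; split; [exact: a1|exact: b1].
split.
- rewrite /peirce_relation !big_ord_recl !big_ord0 lam1 lam2 lam3.
  apply: (mulfI two0); rewrite mulr0.
  have -> : 2 * (4 * (b * (a * (l3 * 1))) - (b + (a + (l3 + 0))) + 1)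
     = 2 * a * (2 * b) * (2 * l3) - 2 * a - 2 * b - 2 * l3 + 2 by ring.
  rewrite l3E.
  have -> : 2 * a * (2 * b) * (x + y) - 2 * a - 2 * b - (x + y) + 2 =
    2 * a * (y + 2 * b * x - 1) + 2 * b * (x + 2 * a * y - 1)
      - (x + 2 * a * y - 1) - (y + 2 * b * x - 1) by ring.
  by rewrite ex ey; ring.
- have neq : forall i, 2 * lam i - 1 != 0.
    by apply: forall_ord3; rewrite ?lam1 ?lam2 ?lam3.
  move=> i; split; rewrite ?chiE //.
    by field; rewrite two0 four0.
  by rewrite mulf_neq0 ?invr_eq0.
rewrite !big_ord_recl big_ord0 !chiE lam1 lam2 lam3 -/c1 -/c2 -/c3 e3 addr0.
rewrite !scalerDr !scalerA.
rewrite [X in _ + X]addrCA [LHS]addrA -!scalerDl.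
(* These factorizations turn the coefficients of [c1] and [c2] into
   cancelling pairs. *)
have l3x : 2 * l3 - 1 = - x * (2 * b - 1) by rewrite l3E -[in LHS]ey; ring.
have l3y : 2 * l3 - 1 = - y * (2 * a - 1) by rewrite l3E -[in LHS]ex; ring.
rewrite [X in X *: c1](_ : _ = 0); last first.
  by rewrite l3x; field; rewrite lam1_neq oppr_eq0 x0 four0.
rewrite [X in X *: c2](_ : _ = 0) ?scale0r ?addr0 //.
by rewrite l3y; field; rewrite lam2_neq oppr_eq0 y0 four0.
Qed.

(** * Extension of scalars *)

Section BaseChange.
Variables (K L : fieldType) (iota : {rmorphism K -> L}) (A : comm_algebra K).
Local Notation emb := (base_change_emb iota (A := A)).

Lemma dim_base_change : \dim {:base_change iota A} = \dim {:A}.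
Proof. by rewrite dimvf /= /dim /= mul1n. Qed.

Lemma base_change_emb_combination (x y : K) (u v : A) :
  emb (x *: u + y *: v) = iota x *: emb u + iota y *: emb v.
Proof.
by apply/rowP => k; rewrite !mxE linearP linearZ rmorphD !rmorphM.
Qed.

Lemma base_change_emb_inj : injective emb.
Proof.
move=> u v /rowP e.
rewrite (coord_vbasis (memvf u)) (coord_vbasis (memvf v)).
apply: eq_bigr => k _; congr (_ *: _).
by have := e k; rewrite !mxE => /fmorph_inj.
Qed.

Lemma base_change_emb_idempotent (u : A) :
  alg_idempotent (emb u) = alg_idempotent u.
Proof.
by rewrite /alg_idempotent -base_change_embM (inj_eq base_change_emb_inj).
Qed.

Lemma base_change_emb_eq0 (u : A) : (emb u == 0) = (u == 0).
Proof.
rewrite -(inj_eq base_change_emb_inj); congr (_ == _).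
by apply/rowP => k; rewrite !mxE linear0 rmorph0.
Qed.

End BaseChange.

(** The multiplication table of [c] and [d] is preserved by the base change,
    where the same classification lists the four idempotents. *)
Lemma generic_of_pair (R : realType) (K : fieldType)
    (iota : {rmorphism K -> R[i]}) (A : comm_algebra K)
    (c d : A) (a b x y : K) : \dim {:A} = 2%N ->
    c != 0 -> d != 0 -> c != d -> alg_idempotent c -> alg_idempotent d ->
    alg_mul c d = a *: c + b *: d -> 1 - 4 * a * b != 0 ->
    x != 0 -> y != 0 -> x + 2 * a * y = 1 -> y + 2 * b * x = 1 ->
  generic iota A.
Proof.
move=> dimA c0 d0 cd cc dd mulcd D0 x0 y0 ex ey.
pose emb := base_change_emb iota (A := A).
have c0' : emb c != 0 by rewrite base_change_emb_eq0.
have d0' : emb d != 0 by rewrite base_change_emb_eq0.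
have cd' : emb c != emb d by rewrite (inj_eq (@base_change_emb_inj _ _ _ _)).
have cc' : alg_idempotent (emb c) by rewrite base_change_emb_idempotent.
have dd' : alg_idempotent (emb d) by rewrite base_change_emb_idempotent.
have mulcd' : alg_mul (emb c) (emb d) = iota a *: emb c + iota b *: emb d.
  by rewrite -base_change_embM mulcd base_change_emb_combination.
have x0' : iota x != 0 by rewrite fmorph_eq0.
have y0' : iota y != 0 by rewrite fmorph_eq0.
exists [:: 0; emb c; emb d; iota x *: emb c + iota y *: emb d]; split.
- rewrite /= !inE !(eq_sym _ (_ + _)).
  rewrite (combination_eq0 c0' d0') // (combination_eqc c0' d0') //.
  rewrite (combination_eqd c0' d0') // (negPf x0') (negPf y0') !andbF.
  by rewrite !(eq_sym 0) (negPf c0') (negPf d0') (negPf cd').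
- by rewrite dimA.
apply: (idempotents_of_pair _ c0' d0' cd' cc' dd' mulcd') => //.
- by rewrite dim_base_change.
- have -> : 1 - 4 * iota a * iota b = iota (1 - 4 * a * b).
    by rewrite rmorphB !rmorphM rmorph1 rmorph_nat.
  by rewrite fmorph_eq0.
- by rewrite -[RHS](rmorph1 iota) -ex rmorphD !rmorphM rmorph_nat.
- by rewrite -[RHS](rmorph1 iota) -ey rmorphD !rmorphM rmorph_nat.
Qed.

(** * The algebra with a prescribed product of two idempotents *)

Section Construction.
Variables (K : fieldType) (a b : K).

(** The product for which the standard basis vectors [e_0], [e_1] are
    idempotents with [e_0 e_1 = a e_0 + b e_1]. *)
Definition pair_mul (u v : 'rV[K]_2) : 'rV[K]_2 :=
  \row_k (u 0 k * v 0 k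
          + (if k == 0 then a else b) * (u 0 0 * v 0 1 + u 0 1 * v 0 0)).

Fact pair_mulC : commutative pair_mul.
Proof. by move=> u v; apply/rowP => k; rewrite !mxE; ring. Qed.

Fact pair_mul_linear u : linear (pair_mul u).
Proof. by move=> t v w; apply/rowP => k; rewrite !mxE; ring. Qed.

Definition pair_algebra : comm_algebra K :=
  CommAlgebra pair_mulC pair_mul_linear.

End Construction.

Lemma forall_ord2 (P : 'I_2 -> Prop) : P 0 -> P 1 -> forall i, P i.
Proof.
move=> P0 P1 [[|[|//]] lti].
- by rewrite (_ : Ordinal lti = 0) //; apply: val_inj.
- by rewrite (_ : Ordinal lti = 1) //; apply: val_inj.
Qed.

Lemma exists_pair_algebra (K : fieldType) (a b : K) :
  exists (A : comm_algebra K) (c d : A),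
    [/\ \dim {:A} = 2%N, [/\ c != 0, d != 0 & c != d],
        alg_idempotent c, alg_idempotent d
      & alg_mul c d = a *: c + b *: d].
Proof.
have e0 : (delta_mx 0 0 : 'rV[K]_2) 0 0 = 1 by rewrite mxE.
have e1 : (delta_mx 0 0 : 'rV[K]_2) 0 1 = 0 by rewrite mxE.
have f0 : (delta_mx 0 1 : 'rV[K]_2) 0 0 = 0 by rewrite mxE.
have f1 : (delta_mx 0 1 : 'rV[K]_2) 0 1 = 1 by rewrite mxE.
exists (pair_algebra a b), (delta_mx 0 0 : 'rV_2), (delta_mx 0 1 : 'rV_2).
have nz := oner_neq0 K.
split; first by rewrite dimvf /= /dim /=.
- split; apply: contraNneq nz.
  + by move=> h; rewrite -e0 h mxE.
  + by move=> h; rewrite -f1 h mxE.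
  + by move=> h; rewrite -e0 h f0.
- apply/eqP/rowP; apply: forall_ord2; rewrite mxE ?e0 ?e1 /=; ring.
- apply/eqP/rowP; apply: forall_ord2; rewrite mxE ?f0 ?f1 /=; ring.
apply/rowP; apply: forall_ord2; rewrite !mxE /=; ring.
Qed.

(** * The theorem *)

Theorem theorem4p2 (R : realType) (K : fieldType)
    (iota : {rmorphism K -> R[i]}) :
  (forall A : comm_algebra K,
     \dim {:A} = 2%N -> generic iota A ->
     three_idempotent_identities A
     /\ three_idempotent_identities (base_change iota A))
  /\
  (forall lam : 'I_3 -> K,
     (forall i, lam i != 2^-1) ->
     peirce_relation lam ->
     exists A : comm_algebra K,
       [/\ \dim {:A} = 2%N,
           generic iota A
         & exists c : 'I_3 -> A,
             [/\ injective c,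
                 forall i, c i != 0,
                 forall i, alg_idempotent (c i)
               & forall i, has_peirce_spectrum (c i) [:: 1; lam i]]]).
Proof.
have char0L : [pchar R[i]] =i pred0 by exact: Num.Theory.pchar_num.
have char0 : [pchar K] =i pred0 by move=> p; rewrite -(fmorph_pchar iota).
split.
  move=> A dimA [s [us szs sE]].
  have bound (t : seq (base_change iota A)) : uniq t ->
      all (@alg_idempotent _ _) t -> (size t <= 4)%N.
    move=> ut /allP idt; have -> : 4%N = size s by rewrite szs dimA.
    by apply: uniq_leq_size => // z /idt; rewrite sE.
  split; apply: three_idempotent_identities_of_bound => //.
    move=> t ut idt; rewrite -(size_map (base_change_emb iota (A := A))).
    apply: bound.
      by rewrite map_inj_uniq //; exact: base_change_emb_inj.
    rewrite all_map; apply: sub_all idt => u /=.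
    by rewrite base_change_emb_idempotent.
  by rewrite dim_base_change.
move=> lam lam_half rel.
have two0 : 2 != 0 :> K by rewrite (pcharf0P K).1.
have lam_half' i : 2 * lam i != 1.
  apply: contraNneq (lam_half i) => e.
  by apply/eqP/(mulfI two0); rewrite e divff.
move: rel; rewrite /peirce_relation !big_ord_recl !big_ord0 mulr1 addr0.
set b := lam ord0; set a := lam (lift ord0 ord0).
set l := lam (lift ord0 (lift ord0 ord0)) => rel.
have a0 : 1 - 2 * a != 0 by rewrite subr_eq0 eq_sym lam_half'.
have b0 : 1 - 2 * b != 0 by rewrite subr_eq0 eq_sym lam_half'.
have lD : (1 - 4 * a * b) * l = 1 - a - b.
  by apply/eqP; rewrite -subr_eq0 -oppr_eq0 -rel; apply/eqP; ring.
(* If [4 a b = 1], the relation forces [a + b = 1], hence [a = b = 1/2]. *)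
have D0 : 1 - 4 * a * b != 0.
  apply: contraNneq a0 => D0; move: lD; rewrite D0 mul0r => ab.
  rewrite -sqrf_eq0.
  have -> : (1 - 2 * a) ^+ 2 = 1 - 4 * a * b - 4 * a * (1 - a - b) by ring.
  by rewrite D0 -ab mulr0 subr0.
(* Cramer's rule for [x + 2 a y = 1], [y + 2 b x = 1]. *)
pose x := (1 - 2 * a) / (1 - 4 * a * b).
pose y := (1 - 2 * b) / (1 - 4 * a * b).
have x0 : x != 0 by rewrite mulf_neq0 ?invr_eq0.
have y0 : y != 0 by rewrite mulf_neq0 ?invr_eq0.
have ex : x + 2 * a * y = 1 by rewrite /x /y; field.
have ey : y + 2 * b * x = 1 by rewrite /x /y; field.
have lE : l = x + a * y - b * x.
  by apply: (mulfI D0); rewrite lD /x /y; field.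
have [A [c [d [dimA [c0 d0 cd] cc dd mulcd]]]] := exists_pair_algebra a b.
exists A; split=> //.
  exact: (generic_of_pair iota dimA c0 d0 cd cc dd mulcd D0 x0 y0 ex ey).
pose z := x *: c + y *: d.
have iz : alg_idempotent z.
  by rewrite (idempotent_combination c0 d0 cd cc dd mulcd) ex ey subrr
    !mulr0 eqxx.
have z0 : z != 0 by rewrite (combination_eq0 c0 d0) // (negPf x0).
have zc : z != c by rewrite (combination_eqc c0 d0) // (negPf y0) andbF.
have zd : z != d by rewrite (combination_eqd c0 d0) // (negPf x0).
exists (fun i => nth 0 [:: c; d; z] i); split.
- have un : uniq [:: c; d; z].
    by rewrite /= !inE negb_or cd (eq_sym c) zc (eq_sym d) zd.
  by move=> i j /eqP; rewrite nth_uniq // => /eqP /val_inj.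
- exact: forall_ord3.
- exact: forall_ord3.
apply: forall_ord3; rewrite /= -/a -/b -/l ?lE.
- exact: (spectrum_left dimA c0 d0 cd cc dd mulcd).
- exact: (spectrum_right dimA c0 d0 cd cc dd mulcd).
- exact: (spectrum_combination dimA c0 d0 cd cc dd mulcd).
Qed.
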